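(* Let $x=(x_n)_{n\in\mathbf{N}}$ be a sequence taking values in a smooth compact metric space $X$ and let $\mathcal{I}$ be a maximal ideal on $\mathbf{N}$. Then $x$ has exactly one $\mathcal{I}$-cluster point. In particular, $\Lambda_x(\mathcal{I})$ is closed.
   Context: $\mathbf{N}$ denotes the positive integers. An ideal $\mathcal{I}$ on $\mathbf{N}$ is a collection of subsets of $\mathbf{N}$ closed under finite unions and subsets; it is assumed to contain the family $\mathrm{Fin}$ of finite subsets of $\mathbf{N}$ and to be different from $\mathcal{P}(\mathbf{N})$. An ideal is maximal if it is maximal with respect to inclusion among such ideals. A metric space $(X,d)$ is called smooth if $\lim_{k\to\infty}\sup_{a\in X}\mathrm{diam}\,\overline{B(a,1/k)}=0$, where $B(a,r)$ is the open ball with center $a$ and radius $r$, the bar denotes closure, and $\mathrm{diam}\,S=\sup_{a,b\in S}d(a,b)$. An $\mathcal{I}$-cluster point of $x$ is a point $\ell\in X$ such that $\{n:x_n\in U\}\notin\mathcal{I}$ for every neighborhood $U$ of $\ell$. $\Lambda_x(\mathcal{I})$ (the $\mathcal{I}$-limit points of $x$) is the set of all $\ell\in X$ such that $\lim_{k\to\infty}x_{n_k}=\ell$ for some subsequence $(x_{n_k})$ with $\{n_k:k\in\mathbf{N}\}\notin\mathcal{I}$. *)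

(* Defs.v *)
From HB Require Import structures.
From mathcomp Require Import all_boot all_order all_algebra.
From mathcomp Require Import all_classical all_reals all_analysis.

Set Implicit Arguments.
Unset Strict Implicit.
Unset Printing Implicit Defensive.

Import Order.TTheory GRing.Theory Num.Theory.
Import numFieldNormedType.Exports.

Local Open Scope classical_set_scope.
Local Open Scope ring_scope.

Definition posint := {n : nat | (0 < n)%N}.

Record is_ideal (I : set (set posint)) : Prop := IsIdeal {
  ideal_setU : forall A B, I A -> I B -> I (A `|` B) ;
  ideal_subset : forall A B, A `<=` B -> I B -> I A ;
  ideal_finite : forall A, finite_set A -> I A ;
  ideal_proper : I <> [set: set posint] }.

Definition maximal_ideal (I : set (set posint)) : Prop :=
  is_ideal I /\ forall J, is_ideal J -> I `<=` J -> J = I.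

(* The supremum is taken in the extended reals, so an unbounded set has
   diameter +oo (and the empty set has diameter -oo). *)
Definition diam (R : realType) (X : metricType R) (S : set X) : \bar R :=
  ereal_sup [set (mdist p.1 p.2)%:E | p in S `*` S].

(* k ranges over nat from 0, hence the radius 1/(k+1). *)
Definition smooth (R : realType) (X : metricType R) : Prop :=
  (fun k : nat =>
     ereal_sup (range (fun a : X => diam (closure (ball a k.+1%:R^-1)))))
    @ \oo --> (0 : \bar R)%E.

Definition ideal_cluster_points (R : realType) (X : metricType R)
    (I : set (set posint)) (x : posint -> X) : set X :=
  [set l | forall U : set X, nbhs l U -> ~ I [set n | U (x n)]].

Definition ideal_limit_points (R : realType) (X : metricType R)
    (I : set (set posint)) (x : posint -> X) : set X :=
  [set l | exists n_ : nat -> posint,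
     [/\ forall k, (val (n_ k) < val (n_ k.+1))%N,
         ~ I (range n_) &
         (fun k => x (n_ k)) @ \oo --> l]].

(* Main.v *)
Require Import Defs.
From mathcomp Require Import all_boot all_order all_algebra.
From mathcomp Require Import all_classical all_reals all_analysis.

Local Open Scope classical_set_scope.

(** The complements of the members of [I] form a filter, so by compactness the
    image of this filter under [x] has a cluster point, which is an [I]-cluster
    point. Maximality of [I] means that every set or its complement lies in
    [I]; hence two disjoint neighbourhoods cannot both have preimages outside
    [I], and the [I]-cluster point is unique because [X] is Hausdorff. As every
    [I]-limit point is an [I]-cluster point, there is at most one. *)

Lemma ideal_setTN (I : set (set posint)) : is_ideal I -> ~ I setT.
Proof.
move=> II IT; apply: (ideal_proper II); apply/seteqP; split=> A // _.
exact: (ideal_subset II (@subsetT _ A)).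
Qed.

(** Adjoining [A] to [I] generates a family [J] strictly larger than [I], so by maximality [J]
    contains [setT]: some member of [I] then covers the complement of [A]. *)
Lemma maximal_ideal_setC (I : set (set posint)) (A : set posint) :
  maximal_ideal I -> ~ I A -> I (~` A).
Proof.
move=> [II Imax] NIA.
pose J : set (set posint) := [set B | exists2 C, I C & B `<=` C `|` A].
have IJ : I `<=` J by move=> B IB; exists B => // n; left.
have [[C IC sC]|NJT] := pselect (J setT).
  by apply: (ideal_subset II _ IC) => n nA; case: (sC n).
have J_ideal : is_ideal J.
  split.
  - move=> B1 B2 [C1 I1 s1] [C2 I2 s2]; exists (C1 `|` C2).
      exact: ideal_setU.
    by move=> n [/s1|/s2] [] ?; [left; left|right|left; right|right].
  - by move=> B B' sB [C IC sC]; exists C => // n /sB/sC.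
  - by move=> B /(ideal_finite II)/IJ.
  - by move=> JT; apply: NJT; rewrite JT.
have JA : J A.
  by exists set0; [exact: (ideal_finite II (finite_set0 _))|move=> n; right].
by case: NIA; rewrite -(Imax _ J_ideal IJ).
Qed.

Lemma ideal_dual_proper_filter (I : set (set posint)) :
  is_ideal I -> ProperFilter [set A | I (~` A)].
Proof.
move=> II; split; first by rewrite /= setC0; exact: ideal_setTN.
split => /=.
- by rewrite setCT; exact: (ideal_finite II (finite_set0 _)).
- by move=> A B IA IB; rewrite /= setCI; exact: ideal_setU.
- by move=> A B /subsetC sAB; exact: (ideal_subset II sAB).
Qed.

Lemma ideal_cluster_points_nonempty (R : realType) (X : metricType R)
    (I : set (set posint)) (x : posint -> X) :
  compact [set: X] -> is_ideal I -> ideal_cluster_points I x !=set0.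
Proof.
move=> cX II; have FF := ideal_dual_proper_filter _ II.
have [l [_ xl]] := cX (fmap x [set A | I (~` A)]) _ filterT.
exists l => U lU IU.
(* If the preimage of [U] is in [I], the complement of [U] is in the image filter, so clustering at
   [l] makes it meet [U]. *)
have NUF : fmap x [set A | I (~` A)] (~` U).
  by rewrite /fmap/= -preimage_setC setCK.
by have [y []] := xl _ _ NUF lU.
Qed.

Lemma maximal_ideal_cluster_points_unique (R : realType) (X : metricType R)
    (I : set (set posint)) (x : posint -> X) (l m : X) :
  maximal_ideal I ->
  ideal_cluster_points I x l -> ideal_cluster_points I x m -> l = m.
Proof.
(* Hausdorff separation in contrapositive form: it suffices that [U] and [V] always meet. *)
move=> Imax xl xm; apply: (@metric_hausdorff R X) => U V lU mV.
apply/set0P/negP => /eqP UV0.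
apply: (xm V mV); apply: (ideal_subset Imax.1 _ (maximal_ideal_setC _ _ Imax (xl U lU))).
by move=> n Vn Un; suff: (set0 : set X) (x n) by []; rewrite -UV0.
Qed.

Lemma ideal_limit_points_subset (R : realType) (X : metricType R)
    (I : set (set posint)) (x : posint -> X) :
  is_ideal I -> ideal_limit_points I x `<=` ideal_cluster_points I x.
Proof.
move=> II l [n_ [_ NIn xl]] U lU IU; apply: NIn.
have [N _ NU] := xl U lU.
(* Only the finitely many indices [n_ k] with [k < N] can fall outside the preimage of [U]. *)
apply: (ideal_subset II (B := n_ @` `I_N `|` [set n | U (x n)])).
  move=> _ [k _ <-]; have [kN|Nk] := ltnP k N; first by left; exists k.
  by right; exact: NU.
apply: (ideal_setU II) => //; apply: (ideal_finite II).
exact/finite_image/finite_II.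
Qed.

Theorem proposition4p2 (R : realType) (X : metricType R)
    (X_compact : compact [set: X]) (X_smooth : smooth X)
    (I : set (set posint)) (I_maximal : maximal_ideal I)
    (x : posint -> X) :
  (exists! l : X, ideal_cluster_points I x l) /\
  closed (ideal_limit_points I x).
Proof.
have [II _] := I_maximal.
have [l xl] := ideal_cluster_points_nonempty _ _ _ x X_compact II.
have xE m : ideal_cluster_points I x m -> l = m.
  exact: maximal_ideal_cluster_points_unique.
split; first by exists l.
have : ideal_limit_points I x `<=` [set l].
  by move=> m /(ideal_limit_points_subset _ _ _ _ II)/xE <-.
(* The limit set is empty or the singleton of [l], which is closed as metric spaces are T1. *)
move/subset_set1 => [->|->]; first exact: closed0.
exact/accessible_closed_set1/hausdorff_accessible/metric_hausdorff.
Qed.
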